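(* Let $A\in\mathbb{M}_n^+$ and $p\ge1$. Then, for any $T\in\mathbb{M}_n$, $$\left|A\frac{T+T^*}{2}A\right|^p\prec_{w\log}A^p\,\frac{|T|^p+|T^*|^p}{2}\,A^p.$$
   Context: $\mathbb{M}_n$ is the space of $n\times n$ complex matrices, $\mathbb{M}_n^+$ its positive semidefinite part, and $|X|=(X^*X)^{1/2}$. For $R,S\in\mathbb{M}_n^+$, $R\prec_{w\log}S$ means $\prod_{j=1}^k\lambda_j(R)\le\prod_{j=1}^k\lambda_j(S)$ for every $k=1,\ldots,n$, where $\lambda_1(\cdot)\ge\cdots\ge\lambda_n(\cdot)$ are the eigenvalues arranged in decreasing order (with multiplicity). *)

(* Defs.v *)
From mathcomp Require Import all_boot all_order all_algebra.
From mathcomp.real_closed Require Import complex.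
From mathcomp Require Import reals exp.

Set Implicit Arguments.
Unset Strict Implicit.
Unset Printing Implicit Defensive.

Import Order.TTheory GRing.Theory Num.Theory.
Local Open Scope ring_scope.
Local Open Scope sesquilinear_scope.
Local Open Scope complex_scope.

Definition psdmx (R : realType) (n : nat) (A : 'M[R[i]]_n) : Prop :=
  A \is hermsymmx /\ forall x : 'cV[R[i]]_n, 0 <= (x ^t* *m A *m x) 0 0.

(* Functional calculus A |-> A^p along a unitary diagonalization of A;
   meaningful for positive semidefinite A, where every diagonal entry is a
   nonnegative real (so taking its real part loses nothing) and, for p != 0,
   zero eigenvalues are sent to zero. *)
Definition mxpow (R : realType) (n : nat) (A : 'M[R[i]]_n) (p : R) :
    'M[R[i]]_n :=
  invmx (spectralmx A)
    *m diag_mx (map_mx (fun z : R[i] => (powR (complex.Re z) p)%:C)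
                       (spectral_diag A))
    *m spectralmx A.

Definition mxabs (R : realType) (n : nat) (X : 'M[R[i]]_n) : 'M[R[i]]_n :=
  mxpow (X ^t* *m X) 2^-1.

(* Roots of the characteristic polynomial, listed with multiplicity. *)
Definition mxspectrum (R : realType) (n : nat) (A : 'M[R[i]]_n) : seq R[i] :=
  sval (closed_field_poly_normal (char_poly A)).

(* eigval_desc A j is the (j+1)-th largest eigenvalue; the eigenvalues of a
   Hermitian matrix are real, so they are compared through their real parts,
   the order on R[i] being only partial. *)
Definition eigval_desc (R : realType) (n : nat) (A : 'M[R[i]]_n) (j : nat) : R :=
  nth 0 (sort (fun x y : R => y <= x)
              [seq complex.Re z | z <- mxspectrum A]) j.

(* Only meant for positive semidefinite A and B. *)
Definition wlog_majorized (R : realType) (n : nat) (A B : 'M[R[i]]_n) : Prop :=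
  forall k : nat, (1 <= k <= n)%N ->
    \prod_(j < k) eigval_desc A j <= \prod_(j < k) eigval_desc B j.

(* Main.v *)
(* Put [E_k M] for the product of the [k] largest eigenvalues, and, for [t >= 0],
   [P_t := A^t ((|T|^t + |T^*|^t) / 2) A^t = F_t^* F_t], where [F_t] stacks
   [|T|^(t/2) A^t / sqrt 2] and [|T^*|^(t/2) A^t / sqrt 2].  For [m := (s + t) / 2],
   the matrix [F_s^* F_t = A^s ((|T|^m + |T^*|^m) / 2) A^t] has the spectrum of [P_m],
   so by Weyl's inequality [t |-> E_k P_t] is midpoint log-convex.  It is bounded on
   [[0, p]] and equals 1 at [0], hence [(E_k P_1)^p <= E_k P_p].  Finally, writing
   [T = L^* Q] with [L^* L = |T^*|] and [Q^* Q = |T|], the matrix [H := A (Re T) A]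
   is [F^* G] with [F^* F = G^* G = P_1], so that [E_k |H| <= E_k P_1].
   The inequalities on [E_k] come from [det (W^* M W) <= E_k M * det (W^* W)] and the
   Cauchy-Schwarz inequality for Gram determinants, both read off the Cauchy-Binet
   formula. *)

Require Import Defs.
From mathcomp Require Import all_boot all_order all_algebra all_fingroup.
From mathcomp.real_closed Require Import complex.
From mathcomp Require Import reals exp.
From mathcomp Require Import ring lra.

Set Implicit Arguments.
Unset Strict Implicit.
Unset Printing Implicit Defensive.

Import Order.TTheory GRing.Theory Num.Theory.
Local Open Scope ring_scope.
Local Open Scope sesquilinear_scope.

(** * Gram determinants *)

(** In the Leibniz formula, the product over the rows of the sums giving the entries of [X *m Y] is
    distributed over all choices [f] of summation indices. *)
Lemma det_mulmx_ffun (R : comNzRingType) k n (X : 'M[R]_(k, n)) (Y : 'M[R]_(n, k)) :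
  \det (X *m Y) =
  \sum_(f : {ffun 'I_k -> 'I_n}) (\prod_i X i (f i)) * \det (rowsub f Y).
Proof.
transitivity (\sum_(f : {ffun 'I_k -> 'I_n}) \sum_(s : 'S_k)
    (-1) ^+ s * \prod_i (X i (f i) * Y (f i) (s i))).
  rewrite exchange_big; apply: eq_bigr => s _ /=.
  rewrite -big_distrr -(bigA_distr_bigA (fun i j => X i j * Y j (s i))) /=.
  by congr (_ * _); apply: eq_bigr => i _; rewrite mxE.
apply: eq_bigr => f _; rewrite big_distrr; apply: eq_bigr => s _ /=.
rewrite big_split mulrCA /=; congr (_ * (_ * _)).
by apply: eq_bigr => i _; rewrite !mxE.
Qed.

(* The Cauchy-Binet formula, summed over all index families instead of the
   increasing ones; hence the factor [k`!]. *)
Lemma Cauchy_Binet (R : comNzRingType) k n (X : 'M[R]_(k, n)) (Y : 'M[R]_(n, k)) :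
  \det (X *m Y) *+ k`! =
  \sum_(f : {ffun 'I_k -> 'I_n}) \det (colsub f X) * \det (rowsub f Y).
Proof.
pose shift (s : 'S_k) (f : {ffun 'I_k -> 'I_n}) := [ffun i => f (s i)].
(* Take [k!] copies of the determinant, one per permutation [s], and reindex each by its own
   [shift s]: the sign of [s] leaves the minor of [Y], and the sum over [s] assembles the minor of
   [X]. *)
transitivity (\sum_(s : 'S_k) \det (X *m Y)).
  by rewrite sumr_const card_Sn.
transitivity (\sum_(f : {ffun 'I_k -> 'I_n}) \sum_(s : 'S_k)
    (-1) ^+ s * (\prod_i X i (f (s i))) * \det (rowsub f Y)).
  rewrite [RHS]exchange_big /=; apply: eq_bigr => s _.
  rewrite det_mulmx_ffun (reindex (shift s)) /=; last first.
    exists (shift s^-1)%g => f _; apply/ffunP => i; rewrite !ffunE.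
      by rewrite permKV.
    by rewrite permK.
  apply: eq_bigr => f _.
  have -> : rowsub (shift s f) Y = row_perm s (rowsub f Y).
    by apply/matrixP => i j; rewrite !mxE ffunE.
  rewrite row_permE det_mulmx det_perm mulrA [_ * (-1) ^+ _]mulrC.
  by congr (_ * _ * _); apply: eq_bigr => i _; rewrite ffunE.
apply: eq_bigr => f _; rewrite -big_distrl; congr (_ * _); apply: eq_bigr => s _.
by congr (_ * _); apply: eq_bigr => i _; rewrite !mxE.
Qed.

Section Gram.
Variable C : numClosedFieldType.

Lemma det_trmxC k (M : 'M[C]_k) : \det (M ^t*) = (\det M)^*.
Proof. by rewrite det_map_mx det_tr. Qed.

Lemma trmxC_mul m n p (M : 'M[C]_(m, n)) (N : 'M[C]_(n, p)) :
  (M *m N) ^t* = N ^t* *m M ^t*.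
Proof. by rewrite trmx_mul map_mxM. Qed.

Lemma det_gram k n (X Y : 'M[C]_(n, k)) :
  \det (X ^t* *m Y) *+ k`! =
  \sum_(f : {ffun 'I_k -> 'I_n}) (\det (rowsub f X))^* * \det (rowsub f Y).
Proof.
rewrite Cauchy_Binet; apply: eq_bigr => f _; congr (_ * _).
rewrite -det_trmxC; congr (\det _).
by apply/matrixP => i j; rewrite !mxE.
Qed.

Lemma sum_Cauchy_Schwarz (I : finType) (u v : I -> C) :
  `|\sum_i (u i)^* * v i| ^+ 2 <= (\sum_i `|u i| ^+ 2) * (\sum_i `|v i| ^+ 2).
Proof.
pose row (w : I -> C) := \row_(j < #|I|) w (enum_val j).
have rowE a b : \sum_i (a i)^* * b i = dotmx (row b) (row a).
  rewrite dotmxE mxE (reindex (@enum_val I I)) /=; last first.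
    by apply: onW_bij; exact: enum_val_bij.
  by apply: eq_bigr => i _; rewrite !mxE mulrC.
have sqE a : \sum_i `|a i| ^+ 2 = dotmx (row a) (row a).
  by rewrite -rowE; apply: eq_bigr => i _; rewrite normCK mulrC.
by rewrite rowE !sqE mulrC; exact: CauchySchwarz.
Qed.

Lemma det_gramE k n (X : 'M[C]_(n, k)) :
  \det (X ^t* *m X) *+ k`! =
  \sum_(f : {ffun 'I_k -> 'I_n}) `|\det (rowsub f X)| ^+ 2.
Proof. by rewrite det_gram; apply: eq_bigr => f _; rewrite normCK mulrC. Qed.

Lemma det_gram_ge0 k n (X : 'M[C]_(n, k)) : 0 <= \det (X ^t* *m X).
Proof.
rewrite -(pmulrn_lge0 _ (fact_gt0 k)) det_gramE.
by apply: sumr_ge0 => f _; exact: exprn_ge0.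
Qed.

(** By Cauchy-Binet, [k!] times a Gram determinant is the inner product of two vectors of minors, so
    the scalar inequality applies to these vectors. *)
Lemma det_gram_Cauchy_Schwarz k n (X Y : 'M[C]_(n, k)) :
  `|\det (X ^t* *m Y)| ^+ 2 <= \det (X ^t* *m X) * \det (Y ^t* *m Y).
Proof.
have k0 : 0 < (k`!%:R : C) ^+ 2 by rewrite exprn_gt0// ltr0n fact_gt0.
rewrite -(ler_pM2l k0) -{1}[k`!%:R]ger0_norm ?ler0n// -exprMn -normrM.
rewrite expr2 mulrACA !mulr_natl det_gram !det_gramE.
exact: sum_Cauchy_Schwarz.
Qed.

(** A certificate of independent columns: if the Gram determinant of [X] vanished, Cauchy-Schwarz
    would force [\det (Y *m X) = 0]. *)
Lemma det_gram_gt0 k n (X : 'M[C]_(n, k)) (Y : 'M[C]_(k, n)) :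
  \det (Y *m X) != 0 -> 0 < \det (X ^t* *m X).
Proof.
move=> YX0; rewrite lt_def det_gram_ge0 andbT; apply: contraNneq YX0 => X0.
have := det_gram_Cauchy_Schwarz (Y ^t*) X.
by rewrite X0 mulr0 trmxCK -normrX normr_le0 expf_eq0.
Qed.
End Gram.

(** * Spectra *)

Local Open Scope complex_scope.

Lemma char_poly_similar (F : fieldType) n (P A : 'M[F]_n) : P \in unitmx ->
  char_poly (invmx P *m A *m P) = char_poly A.
Proof.
move=> Pu; rewrite /char_poly.
have QP : map_mx polyC (invmx P) *m map_mx polyC P = 1%:M.
  by rewrite -map_mxM mulVmx// map_mx1.
have -> : char_poly_mx (invmx P *m A *m P) =
    map_mx polyC (invmx P) *m char_poly_mx A *m map_mx polyC P.
  rewrite /char_poly_mx mulmxBr mulmxBl !map_mxM; congr (_ - _).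
  by rewrite scalar_mxC -mulmxA QP mulmx1.
by rewrite !det_mulmx mulrAC -det_mulmx QP det1 mul1r.
Qed.

Lemma psdmx_trmxC (R : realType) n (M : 'M[R[i]]_n) : psdmx M -> M ^t* = M.
Proof.
by move=> [/is_hermitianmxP + _]; rewrite expr0 scale1r => <-.
Qed.

Lemma psdmxP (R : realType) n (M : 'M[R[i]]_n) :
  M ^t* = M -> (forall x : 'cV_n, 0 <= (x ^t* *m M *m x) 0 0) -> psdmx M.
Proof.
by move=> MH Mx; split=> //; apply/is_hermitianmxP; rewrite expr0 scale1r.
Qed.

Section Spectrum.
Variables (R : realType) (n : nat).
Implicit Types (M P : 'M[R[i]]_n) (d : 'rV[R[i]]_n).

Lemma mxspectrum_diag P d : P \in unitmx ->
  perm_eq (mxspectrum (invmx P *m diag_mx d *m P)) [seq d 0 i | i <- enum 'I_n].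
Proof.
move=> Pu; rewrite /mxspectrum; case: closed_field_poly_normal => /= r.
have /monicP-> := char_poly_monic (invmx P *m diag_mx d *m P).
rewrite scale1r char_poly_similar// char_poly_trig ?diag_mx_is_trig//.
move=> dE; rewrite perm_sym; apply: prod_XsubC_eq; rewrite -dE big_map big_enum.
by apply: eq_bigr => i _; rewrite mxE eqxx.
Qed.

Lemma perm_Re_spectrum_diag P d : P \in unitmx ->
  perm_eq [seq complex.Re z | z <- mxspectrum (invmx P *m diag_mx d *m P)]
          [seq complex.Re (d 0 i) | i <- enum 'I_n].
Proof.
move=> /mxspectrum_diag - /(_ d) /(perm_map (@complex.Re R)).
by rewrite -map_comp.
Qed.

Lemma eigval_desc_diag P d : P \in unitmx ->
  exists s : 'S_n, forall j : 'I_n,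
    eigval_desc (invmx P *m diag_mx d *m P) j = complex.Re (d 0 (s j)).
Proof.
move=> Pu; have := perm_Re_spectrum_diag d Pu.
rewrite /eigval_desc; set r := (X in perm_eq X _).
rewrite -(perm_sort (fun x y : R => y <= x)).
set r' := sort _ _.
have -> : [seq complex.Re (d 0 i) | i <- enum 'I_n] =
  [tuple complex.Re (d 0 i) | i < n] by [].
move=> /tuple_permP[s r'E]; exists s => j.
by rewrite r'E -tnth_nth !tnth_mktuple.
Qed.

Lemma size_Re_mxspectrum M :
  size [seq complex.Re z | z <- mxspectrum M] = n.
Proof.
rewrite size_map /mxspectrum; case: closed_field_poly_normal => /= r.
have /monicP-> := char_poly_monic M; rewrite scale1r.
move=> /(congr1 (fun p : {poly R[i]} => size p)).
by rewrite size_char_poly => /eqP; rewrite size_prod_XsubC eqSS => /eqP.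
Qed.

Lemma eigval_desc_mono M i j : (i <= j < n)%N -> eigval_desc M j <= eigval_desc M i.
Proof.
move=> /andP[ij jn]; rewrite /eigval_desc.
apply: (@sorted_leq_nth _ (fun x y : R => y <= x)) => //.
- by move=> y x z xy zx; exact: le_trans zx xy.
- by apply: sort_sorted => x y; exact: le_total.
- by rewrite inE size_sort size_Re_mxspectrum (leq_ltn_trans ij).
- by rewrite inE size_sort size_Re_mxspectrum.
Qed.

End Spectrum.

(** * Positive semidefinite matrices and their powers *)

Lemma diag_similar_mul (F : fieldType) n (P : 'M[F]_n) (d e c : 'rV_n) :
  P \in unitmx -> (forall i, d 0 i * e 0 i = c 0 i) ->
  invmx P *m diag_mx d *m P *m (invmx P *m diag_mx e *m P) =
  invmx P *m diag_mx c *m P.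
Proof.
move=> Pu dec; rewrite !mulmxA mulmxK//; congr (_ *m _).
rewrite -mulmxA mulmx_diag; congr (_ *m diag_mx _).
by apply/rowP => i; rewrite mxE dec.
Qed.

Lemma conj_diag_similar (F : fieldType) n (P A : 'M[F]_n) (d : 'rV_n) i :
  P \in unitmx -> A = invmx P *m diag_mx d *m P ->
  (P *m A *m invmx P) i i = d 0 i.
Proof.
by move=> Pu ->; rewrite !mulmxA mulmxV// mul1mx mulmxK// mxE eqxx.
Qed.

(* Entrywise in the two eigenbases, [N1 *m T = T *m N2] says that an entry of [T]
   vanishes unless the two corresponding eigenvalues agree. *)
Lemma diag_similar_intertwine (F : fieldType) m n (P1 N1 : 'M[F]_m)
    (P2 N2 : 'M[F]_n) (d1 : 'rV_m) (d2 : 'rV_n) (T : 'M[F]_(m, n)) (f : F -> F) :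
  P1 \in unitmx -> P2 \in unitmx ->
  N1 = invmx P1 *m diag_mx d1 *m P1 -> N2 = invmx P2 *m diag_mx d2 *m P2 ->
  N1 *m T = T *m N2 ->
  invmx P1 *m diag_mx (map_mx f d1) *m P1 *m T =
  T *m (invmx P2 *m diag_mx (map_mx f d2) *m P2).
Proof.
move=> u1 u2 -> -> NT; pose U := P1 *m T *m invmx P2.
have TE : T = invmx P1 *m U *m P2 by rewrite /U !mulmxA mulVmx// mul1mx mulmxKV.
have dU : diag_mx d1 *m U = U *m diag_mx d2.
  have := congr1 (fun X => P1 *m X *m invmx P2) NT.
  by rewrite /U !mulmxA mulmxV// mul1mx mulmxK.
clearbody U; rewrite TE !mulmxA mulmxK// mulmxK//; congr (_ *m _).
rewrite -!mulmxA; congr (_ *m _).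
apply/matrixP => i j; have /matrixP/(_ i j) := dU.
rewrite !mul_diag_mx !mul_mx_diag !mxE.
have [->|U0 dUij] := eqVneq (U i j) 0; first by rewrite !mulr0 !mul0r.
have -> : d1 0 i = d2 0 j by apply: (mulIf U0); rewrite dUij mulrC.
exact: mulrC.
Qed.

(** A map that is monotone on nonnegative reals commutes with decreasing sorting of nonnegative
    lists. It serves for [f x = powR x q]. *)
Lemma nth_sort_map (R : realDomainType) (f : R -> R) (r r' : seq R) j :
  {in Num.nneg &, {homo f : x y / x <= y}} -> all (fun x => 0 <= x) r ->
  perm_eq r' [seq f x | x <- r] -> (j < size r)%N ->
  nth 0 (sort (fun x y => y <= x) r') j = f (nth 0 (sort (fun x y => y <= x) r) j).
Proof.
move=> f_homo r0 r'r jr; rewrite -(nth_map 0 0) ?size_sort//.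
have ge_total : total (fun x y : R => y <= x) by move=> x y; exact: le_total.
congr nth; apply: (@sorted_eq _ (fun x y : R => y <= x)).
- by move=> y x z xy zx; exact: le_trans zx xy.
- by move=> x y; rewrite andbC; exact: le_anti.
- exact: sort_sorted.
- apply: (@homo_sorted_in _ _ (fun x => 0 <= x) f (fun x y => y <= x)).
  + by move=> x y x0 y0 yx; exact: f_homo.
  + by rewrite all_sort.
  + exact: sort_sorted.
- rewrite perm_sort; apply: perm_trans r'r _.
  by rewrite perm_sym; apply: perm_map; rewrite perm_sort.
Qed.

Section Psd.
Variables (R : realType) (n : nat).
Implicit Types (M : 'M[R[i]]_n).

Lemma psdmx_spectralP M : psdmx M ->
  M = invmx (spectralmx M) *m diag_mx (spectral_diag M) *m spectralmx M.
Proof. by move=> [/hermitian_normalmx/orthomx_spectralP]. Qed.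

Lemma psdmx_gram m (X : 'M[R[i]]_(m, n)) : psdmx (X ^t* *m X).
Proof.
apply: psdmxP => [|x]; first by rewrite trmxC_mul trmxCK.
rewrite mulmxA -trmxC_mul -mulmxA mxE; apply: sumr_ge0 => i _.
by rewrite !mxE mulrC -normCK exprn_ge0.
Qed.

Lemma psdmx_conj m M (X : 'M[R[i]]_(n, m)) : psdmx M -> psdmx (X ^t* *m M *m X).
Proof.
move=> Mp; apply: psdmxP => [|x].
  by rewrite !trmxC_mul trmxCK (psdmx_trmxC Mp) mulmxA.
by rewrite !mulmxA -trmxC_mul -mulmxA; exact: Mp.2.
Qed.

Lemma psdmxD M N : psdmx M -> psdmx N -> psdmx (M + N).
Proof.
move=> Mp Np; apply: psdmxP => [|x].
  by rewrite linearD map_mxD/= (psdmx_trmxC Mp) (psdmx_trmxC Np).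
by rewrite mulmxDr mulmxDl mxE addr_ge0 ?Mp.2 ?Np.2.
Qed.

Lemma psdmxZ (a : R[i]) M : 0 <= a -> psdmx M -> psdmx (a *: M).
Proof.
move=> a0 Mp; apply: psdmxP => [|x].
  by rewrite linearZ map_mxZ/= (psdmx_trmxC Mp) geC0_conj.
by rewrite -scalemxAr -scalemxAl mxE mulr_ge0 ?Mp.2.
Qed.

Lemma psdmx_diag_ge0 M i : psdmx M -> 0 <= M i i.
Proof.
move=> /proj2/(_ (delta_mx i 0)).
by rewrite -colE trmx_delta map_delta_mx -rowE !mxE.
Qed.

Lemma diag_mx_psd (d : 'rV[R[i]]_n) : (forall i, 0 <= d 0 i) -> psdmx (diag_mx d).
Proof.
move=> d0; apply: psdmxP => [|x].
  apply/matrixP => i j; rewrite !mxE eq_sym.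
  by case: eqP => [->|_]; rewrite ?mulr1n ?mulr0n ?geC0_conj// conjC0.
rewrite mul_mx_diag mxE; apply: sumr_ge0 => i _.
by rewrite !mxE mulrAC mulrC mulr_ge0// mulrC -normCK exprn_ge0.
Qed.

Lemma psdmx_spectral_diag_ge0 M i : psdmx M -> 0 <= spectral_diag M 0 i.
Proof.
move=> Mp; have /psdmx_diag_ge0 - /(_ i) := psdmx_conj ((spectralmx M)^t*) Mp.
rewrite trmxCK -invmx_unitary ?spectral_unitarymx//.
by rewrite (conj_diag_similar _ (spectral_unit M) (psdmx_spectralP Mp)).
Qed.

Lemma Re_spectral_diag M i : psdmx M ->
  (complex.Re (spectral_diag M 0 i))%:C = spectral_diag M 0 i.
Proof.
by move=> Mp; apply/RRe_real/ger0_real/psdmx_spectral_diag_ge0.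
Qed.

Lemma Re_spectral_diag_ge0 M i : psdmx M -> 0 <= complex.Re (spectral_diag M 0 i).
Proof.
by move=> Mp; rewrite -ler0c Re_spectral_diag ?psdmx_spectral_diag_ge0.
Qed.

Lemma mxpow_psd M q : psdmx (mxpow M q).
Proof.
rewrite /mxpow invmx_unitary ?spectral_unitarymx//; apply: psdmx_conj.
by apply: diag_mx_psd => i; rewrite mxE ler0c powR_ge0.
Qed.

(** The scalar law of exponents is a hypothesis because it can fail at [x = 0], where [powR 0 0 = 1]
    but [powR 0 q = 0] for [q != 0]; each sign pattern of exponents settles it separately. *)
Lemma mxpowD M (q r s : R) :
  (forall x : R, 0 <= x -> powR x q * powR x r = powR x s) -> psdmx M ->
  mxpow M q *m mxpow M r = mxpow M s.
Proof.
move=> qrs Mp; apply: diag_similar_mul; first exact: spectral_unit.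
by move=> i; rewrite !mxE -rmorphM/= qrs ?Re_spectral_diag_ge0.
Qed.

Lemma mxpow0 M : mxpow M 0 = 1%:M.
Proof.
rewrite /mxpow [map_mx _ _](_ : _ = const_mx 1).
  by rewrite diag_const_mx mulmx1 mulVmx// spectral_unit.
by apply/rowP => i; rewrite !mxE powRr0.
Qed.

Lemma mxpow1 M : psdmx M -> mxpow M 1 = M.
Proof.
move=> Mp; rewrite [RHS](psdmx_spectralP Mp) /mxpow.
set d := map_mx _ _; suff -> : d = spectral_diag M by [].
by apply/rowP => i; rewrite mxE powRr1 ?Re_spectral_diag_ge0// Re_spectral_diag.
Qed.

Lemma eigval_desc_mxpow M q (j : 'I_n) : 0 <= q -> psdmx M ->
  eigval_desc (mxpow M q) j = powR (eigval_desc M j) q.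
Proof.
move=> q0 Mp.
have Mperm := perm_Re_spectrum_diag (spectral_diag M) (spectral_unit M).
rewrite -psdmx_spectralP// in Mperm.
apply: (@nth_sort_map _ (fun x => powR x q)); last by rewrite size_Re_mxspectrum.
- by move=> x y x0 y0 xy; exact: ge0_ler_powR.
- rewrite (perm_all _ Mperm); apply/allP => _ /mapP[i _ ->].
  exact: Re_spectral_diag_ge0.
apply: perm_trans (perm_Re_spectrum_diag _ (spectral_unit M)) _.
rewrite perm_sym; apply: perm_trans (perm_map _ Mperm) _.
rewrite -map_comp (@eq_map _ _ _ (fun i => complex.Re (map_mx
    (fun z : R[i] => (powR (complex.Re z) q)%:C) (spectral_diag M) 0 i)))// => i.
by rewrite /= mxE.
Qed.

Lemma eigval_desc_ge0 M (j : 'I_n) : psdmx M -> 0 <= eigval_desc M j.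
Proof.
by move=> Mp; rewrite -(mxpow1 Mp) eigval_desc_mxpow// powR_ge0.
Qed.

End Psd.

Lemma mxpow_intertwine (R : realType) m n (N1 : 'M[R[i]]_m) (N2 : 'M[R[i]]_n)
    (T : 'M[R[i]]_(m, n)) q : psdmx N1 -> psdmx N2 ->
  N1 *m T = T *m N2 -> mxpow N1 q *m T = T *m mxpow N2 q.
Proof.
move=> p1 p2; apply: diag_similar_intertwine; try exact: spectral_unit.
  exact: psdmx_spectralP.
exact: psdmx_spectralP.
Qed.

(** * Products of the largest eigenvalues *)

Section GramDiag.
Variable C : numClosedFieldType.

(** Cauchy-Binet makes the left side a sum of squared minors of [W] weighted by products of entries
    of [d]. A repeated row kills the minor of a non-injective [f], so only products over distinct
    indices need a bound. *)
Lemma det_gram_diag_le k n (W : 'M[C]_(n, k)) (d : 'rV_n) (c : C) :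
  (forall f : 'I_k -> 'I_n, injective f -> \prod_i d 0 (f i) <= c) ->
  \det (W ^t* *m (diag_mx d *m W)) <= c * \det (W ^t* *m W).
Proof.
move=> dc; have k0 : 0 < k`!%:R :> C by rewrite ltr0n fact_gt0.
rewrite -(ler_pM2l k0) mulrCA !mulr_natl det_gram det_gramE mulr_sumr.
apply: ler_sum => f _.
have -> : rowsub f (diag_mx d *m W) = diag_mx (\row_i d 0 (f i)) *m rowsub f W.
  by rewrite !mul_diag_mx; apply/matrixP => i j; rewrite !mxE.
rewrite det_mulmx det_diag mulrCA -[_^* * _]mulrC -normCK.
have [/injectiveP f_inj|/injectivePn[i [j ij fij]]] := boolP (injectiveb f).
  apply: ler_wpM2r; first exact: exprn_ge0.
  by under eq_bigr do rewrite mxE; exact: dc.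
rewrite (determinant_alternate ij) ?normr0 ?expr0n ?mulr0// => l.
by rewrite !mxE fij.
Qed.

Lemma colsub_eigenvectors k n (P M : 'M[C]_n) (d : 'rV_n) (g : 'I_k -> 'I_n) :
  P \is unitarymx -> injective g -> M = invmx P *m diag_mx d *m P ->
  let V := colsub g (P ^t*) in
  V ^t* *m V = 1%:M /\ M *m V = V *m diag_mx (\row_j d 0 (g j)).
Proof.
move=> /unitarymxP PP g_inj ->.
have -> : colsub g (P ^t*) = P ^t* *m colsub g 1%:M.
  by rewrite mulmx_colsub mulmx1.
rewrite /= trmxC_mul trmxCK; split.
  rewrite mulmxA -[X in X *m _]mulmxA PP mulmx1.
  apply/matrixP => i j; rewrite !mxE (bigD1 (g j))//= big1 ?addr0 => [|l lj].
    by rewrite !mxE eqxx mulr1 conjC_nat eq_sym (inj_eq g_inj) eq_sym.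
  by rewrite !mxE (negbTE lj) mulr0.
rewrite invmx_unitary; last exact/unitarymxP.
rewrite -!mulmxA; congr (_ *m _); rewrite [P *m _]mulmxA PP mul1mx.
rewrite mul_diag_mx mul_mx_diag; apply/matrixP => i j; rewrite !mxE.
by case: eqP => [->|_]; rewrite ?mulr0 ?mul0r// mulrC.
Qed.

End GramDiag.

(** Induction on [k]: by pigeonhole one of the [k + 1] distinct indices is at least [k], so its
    factor is at most [e k]; the others form an injective family of size [k]. *)
Lemma ler_prod_injective (R : realDomainType) k n (e : nat -> R) (f : 'I_k -> 'I_n) :
  (forall j : 'I_n, 0 <= e j) -> (forall i j, (i <= j < n)%N -> e j <= e i) ->
  injective f -> \prod_i e (f i) <= \prod_(j < k) e j.
Proof.
move=> e0 e_mono; elim: k f => [|k IH] f f_inj; first by rewrite !big_ord0.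
have [i0 ki0] : exists i0, (k <= f i0)%N.
  apply/existsP; apply: contraT => /existsPn fk.
  have fk' i : (f i < k)%N by rewrite ltnNge fk.
  have /leq_card : injective (fun i => Ordinal (fk' i)).
    by move=> i j /(congr1 val) /= /val_inj /f_inj.
  by rewrite !card_ord ltnn.
rewrite (bigD1_ord i0)//= big_ord_recr/= mulrC.
apply: ler_pM => //; first by apply: prodr_ge0 => i _.
  by apply: IH => i j /f_inj /lift_inj.
by apply: e_mono; rewrite ki0/=.
Qed.

(** The [E_k] of the overview. For positive semidefinite [M] and [k <= n] it is the largest
    eigenvalue of the [k]-th compound matrix of [M]. *)
Definition eigprod (R : realType) n k (M : 'M[R[i]]_n) : R :=
  \prod_(j < k) eigval_desc M j.

Section Eigprod.
Variables (R : realType) (n k : nat) (kn : (k <= n)%N).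
Implicit Types (M P : 'M[R[i]]_n).

Lemma eigprod_ge0 M : psdmx M -> 0 <= eigprod k M.
Proof.
by move=> Mp; apply: prodr_ge0 => j _; exact: (eigval_desc_ge0 (widen_ord kn j)).
Qed.

Lemma eigprod_mxpow M q : 0 <= q -> psdmx M ->
  eigprod k (mxpow M q) = powR (eigprod k M) q.
Proof.
move=> q0 Mp; rewrite /eigprod.
transitivity (\prod_(j < k) powR (eigval_desc M j) q).
  by apply: eq_bigr => j _; exact: (eigval_desc_mxpow (widen_ord kn j)).
have : forall j : 'I_k, 0 <= eigval_desc M j.
  by move=> j; exact: (eigval_desc_ge0 (widen_ord kn j)).
elim: k => [|l IH] M0; first by rewrite !big_ord0 powR1.
rewrite !big_ord_recr/= IH => [|j]; last exact: (M0 (widen_ord (leqnSn l) j)).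
rewrite powRM//; last exact: (M0 ord_max).
by apply: prodr_ge0 => j _; exact: (M0 (widen_ord (leqnSn l) j)).
Qed.

(** A Rayleigh quotient bound for the compound matrix: in an eigenbasis [M] is diagonal, and a
    product of [k] eigenvalues at distinct positions is at most [eigprod k M]. *)
Lemma det_compression_le M (W : 'M[R[i]]_(n, k)) : psdmx M ->
  \det (W ^t* *m M *m W) <= (eigprod k M)%:C * \det (W ^t* *m W).
Proof.
move=> Mp; set P := spectralmx M.
have PP : P ^t* *m P = 1%:M.
  by rewrite -invmx_unitary ?spectral_unitarymx// mulVmx// spectral_unit.
have -> : W ^t* *m M *m W =
    (P *m W) ^t* *m (diag_mx (spectral_diag M) *m (P *m W)).
  rewrite trmxC_mul [X in _ *m X *m _ = _](psdmx_spectralP Mp).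
  by rewrite invmx_unitary ?spectral_unitarymx// !mulmxA.
have -> : W ^t* *m W = (P *m W) ^t* *m (P *m W).
  by rewrite trmxC_mul -mulmxA [P ^t* *m _]mulmxA PP mul1mx.
apply: det_gram_diag_le => f f_inj.
have [s sE] := eigval_desc_diag (spectral_diag M) (spectral_unit M).
rewrite -psdmx_spectralP// in sE.
have -> : \prod_i spectral_diag M 0 (f i) =
    (\prod_i eigval_desc M (s^-1 (f i))%g)%:C.
  rewrite rmorph_prod; apply: eq_bigr => i _.
  by rewrite sE permKV/= Re_spectral_diag.
rewrite lecR; apply: (@ler_prod_injective _ _ n) => [j|i j|i j /perm_inj/f_inj//].
  exact: eigval_desc_ge0.
exact: eigval_desc_mono.
Qed.

(** Orthonormal eigenvectors for the [k] largest eigenvalues; on this frame the bound of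
    [det_compression_le] is attained. *)
Lemma eigvec_frame M : psdmx M ->
  exists (V : 'M[R[i]]_(n, k)) (D : 'M_k),
    [/\ V ^t* *m V = 1%:M, M *m V = V *m D & \det D = (eigprod k M)%:C].
Proof.
move=> Mp.
have [s sE] := eigval_desc_diag (spectral_diag M) (spectral_unit M).
rewrite -psdmx_spectralP// in sE.
have g_inj : injective (fun j : 'I_k => s (widen_ord kn j)).
  by move=> i j /perm_inj /(congr1 val) /= /val_inj.
have [VV MV] := colsub_eigenvectors (spectral_unitarymx M) g_inj (psdmx_spectralP Mp).
eexists; eexists; split; [exact: VV|exact: MV|].
rewrite det_diag rmorph_prod; apply: eq_bigr => j _.
by rewrite mxE -Re_spectral_diag// -sE.
Qed.

End Eigprod.

(** * Weyl-type bounds on products of eigenvalues *)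

Lemma sqr_le_of_complex (R : realType) (w : R[i]) (e a b : R) : 0 < w -> 0 <= e ->
  `|w * e%:C| ^+ 2 <= a%:C * b%:C * (w * w) -> e ^+ 2 <= a * b.
Proof.
move=> w0 e0; rewrite normrM exprMn (ger0_norm (ltW w0)) mulrC -expr2.
rewrite ler_pM2r ?exprn_gt0// ger0_norm ?ler0c//.
by rewrite -rmorphXn -rmorphM lecR.
Qed.

Lemma le_of_complex_sqr_le (R : realType) (e a b : R) :
  0 <= e -> 0 <= a -> 0 <= b ->
  `|e%:C| ^+ 2 <= a%:C * b%:C * e%:C -> e <= a * b.
Proof.
move=> e0 a0 b0; rewrite ger0_norm ?ler0c// -rmorphXn -!rmorphM lecR.
move: e0; rewrite le_eqVlt => /predU1P[<- _|e0]; first exact: mulr_ge0.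
by rewrite expr2 ler_pM2r.
Qed.

Section EigprodMul.
Variables (R : realType) (n k : nat) (kn : (k <= n)%N).
Implicit Types (P : 'M[R[i]]_n).

Lemma eigprod_gram_ge0 m (F : 'M[R[i]]_(m, n)) : 0 <= eigprod k (F ^t* *m F).
Proof. exact/(eigprod_ge0 kn)/psdmx_gram. Qed.

(** Cauchy-Schwarz for the Gram determinants of [F *m U] and [G *m W], followed by
    [det_compression_le] on each factor. *)
Lemma eigprod_gram_Cauchy_Schwarz m (F G : 'M[R[i]]_(m, n)) (U W : 'M_(n, k)) :
  `|\det (U ^t* *m (F ^t* *m G) *m W)| ^+ 2 <=
  (eigprod k (F ^t* *m F))%:C * (eigprod k (G ^t* *m G))%:C *
  (\det (U ^t* *m U) * \det (W ^t* *m W)).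
Proof.
have gramE (F1 G1 : 'M[R[i]]_(m, n)) (U1 W1 : 'M_(n, k)) :
    U1 ^t* *m (F1 ^t* *m G1) *m W1 = (F1 *m U1) ^t* *m (G1 *m W1).
  by rewrite trmxC_mul !mulmxA.
rewrite gramE (le_trans (det_gram_Cauchy_Schwarz _ _))// mulrACA.
by apply: ler_pM; rewrite ?det_gram_ge0// -gramE det_compression_le//;
  exact: psdmx_gram.
Qed.

(* A form of Weyl's inequality: the hypotheses express that [F ^t* *m G] has the
   eigenvalues of [P], the columns of [X *m V] being eigenvectors when those of [V]
   are eigenvectors of [P] for nonzero eigenvalues. *)
Lemma eigprod_sqr_le m (F G : 'M[R[i]]_(m, n)) (P X Z : 'M_n) : psdmx P ->
  F ^t* *m G *m X = X *m P -> Z *m X = P *m P ->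
  eigprod k P ^+ 2 <= eigprod k (F ^t* *m F) * eigprod k (G ^t* *m G).
Proof.
move=> Pp FGX ZX.
have [-> | P0] := eqVneq (eigprod k P) 0.
  by rewrite expr0n mulr_ge0 ?eigprod_gram_ge0.
have [V [D [VV PV detD]]] := eigvec_frame kn Pp.
pose W := X *m V.
have FGW : F ^t* *m G *m W = W *m D by rewrite /W mulmxA FGX -!mulmxA PV.
have ZW : Z *m W = V *m (D *m D).
  by rewrite /W mulmxA ZX -mulmxA PV (mulmxA P) PV mulmxA.
have detW : 0 < \det (W ^t* *m W).
  (* Since [V ^t* *m Z *m W = D *m D] has determinant [eigprod k P ^+ 2], which is nonzero here, the
     columns of [W] are independent. *)
  apply: (@det_gram_gt0 _ _ _ _ (V ^t* *m Z)).
  rewrite -mulmxA ZW (mulmxA (V ^t*)) VV mul1mx det_mulmx detD -rmorphM/= -[0]/(0%:C).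
  by rewrite (inj_eq (@complexI R)) mulf_neq0.
have := eigprod_gram_Cauchy_Schwarz F G W W.
rewrite -(mulmxA (W ^t*)) FGW (mulmxA (W ^t*)) det_mulmx detD.
exact: sqr_le_of_complex detW (eigprod_ge0 kn Pp).
Qed.

(** Test with the top eigenvectors [V] of [H ^t* *m H] and with [U = H *m V]: then [U ^t* *m H *m V]
    and [U ^t* *m U] both have determinant [eigprod k (H ^t* *m H)], one power of which cancels. *)
Lemma eigprod_gram_mul_le m (F G : 'M[R[i]]_(m, n)) (H S1 S2 : 'M_n) :
  F ^t* *m G = H -> F ^t* *m F = S1 -> G ^t* *m G = S2 ->
  eigprod k (H ^t* *m H) <= eigprod k S1 * eigprod k S2.
Proof.
move=> FGH <- <-; have Hp : psdmx (H ^t* *m H) := psdmx_gram H.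
have [V [D [VV HV detD]]] := eigvec_frame kn Hp.
have := eigprod_gram_Cauchy_Schwarz F G (H *m V) V.
rewrite FGH trmxC_mul -!(mulmxA (V ^t*)) -!(mulmxA (H ^t*)).
rewrite (mulmxA (H ^t*)) HV (mulmxA (V ^t*)) VV mul1mx det1 mulr1 detD.
by apply: le_of_complex_sqr_le; rewrite ?eigprod_gram_ge0.
Qed.

(** A crude estimate, sufficient for boundedness: each eigenvalue is nonnegative and at most the
    trace. *)
Lemma eigprod_le_trace P : psdmx P -> (eigprod k P)%:C <= \tr P ^+ k.
Proof.
move=> Pp; rewrite rmorph_prod -[X in _ ^+ X]card_ord -prodr_const.
apply: ler_prod => j _.
rewrite ler0c (eigval_desc_ge0 (widen_ord kn j) Pp)/=.
have [s sE] := eigval_desc_diag (spectral_diag P) (spectral_unit P).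
rewrite -psdmx_spectralP// in sE.
rewrite (sE (widen_ord kn j)) Re_spectral_diag//.
rewrite [X in \tr X](psdmx_spectralP Pp) -mulmxA mxtrace_mulC.
rewrite mulmxK ?spectral_unit// mxtrace_diag (bigD1 (s (widen_ord kn j)))//=.
by rewrite lerDl sumr_ge0// => i _; exact: psdmx_spectral_diag_ge0.
Qed.

Lemma eigprod1 : eigprod k (1%:M : 'M[R[i]]_n) = 1.
Proof.
have p1 : psdmx (1%:M : 'M[R[i]]_n).
  by rewrite -(mxpow0 (0 : 'M[R[i]]_n)); exact: mxpow_psd.
have [V [D [VV IV detD]]] := eigvec_frame kn p1.
(* The eigenvector equation reads [V = V *m D], hence [D = 1]. *)
apply: (@complexI R); rewrite -detD -[D]mul1mx -VV -mulmxA -IV mul1mx.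
by rewrite VV det1.
Qed.

End EigprodMul.

(** * Midpoint log-convexity *)

Lemma powR_le_bound (R : realType) (x t p : R) : 0 <= x -> 0 <= t <= p ->
  powR x t <= 1 + powR x p.
Proof.
move=> x0 /andP[t0 tp]; have [x1|/ltW x1] := leP x 1.
  rewrite ler_wpDr ?powR_ge0// (@le_trans _ _ (powR 1 t))//; last by rewrite powR1.
  by rewrite ge0_ler_powR ?nnegrE.
by rewrite (le_trans (ler_powR x1 tp))// lerDr.
Qed.

Section LogConvex.
Variables (R : realType).

(** A value above 1 would grow beyond [c] under repeated squaring. Quantitatively, each squaring
    halves the excess allowed over 1. *)
Lemma le1_of_sqr_le (T : Type) (phi : T -> R) (c : R) :
  (forall x, 0 <= phi x <= c) -> (forall x, exists y, phi x ^+ 2 <= phi y) ->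
  forall x, phi x <= 1.
Proof.
move=> phi_bd phi_sqr.
have bd N x : phi x <= 1 + c / 2 ^+ N.
  elim: N x => [|N IH] x.
    by rewrite expr0 divr1 ler_wpDl//; case/andP: (phi_bd x).
  have [y xy] := phi_sqr x; have {IH} := le_trans xy (IH y).
  have /andP[x0 xc] := phi_bd x.
  have : 0 <= c / 2 ^+ N.
    by rewrite divr_ge0 ?exprn_ge0//; exact: le_trans x0 xc.
  (* It remains that [a ^+ 2 <= 1 + b] gives [a <= 1 + b / 2], as [(1 + b / 2) ^+ 2 >= 1 + b]. *)
  rewrite [_ ^+ N.+1]exprS invfM mulrCA; move: (c / _) (phi x) x0 => a b b0 a0 ba.
  by nra.
move=> x; rewrite leNgt; apply/negP => x1.
have /andP[x0 xc] := phi_bd x.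
pose e := phi x - 1; have e0 : 0 < e by rewrite subr_gt0.
have ce0 : 0 <= c / e by rewrite divr_ge0 ?(ltW e0)//; exact: le_trans x0 xc.
have := archi_boundP ce0; set N := Num.bound _ => ceN.
have : c / e < 2 ^+ N.
  by rewrite (lt_le_trans ceN)// -natrX ler_nat ltnW// ltn_expl.
rewrite ltr_pdivrMr// mulrC -ltr_pdivrMr ?exprn_gt0// ltNge => /negP; apply.
by rewrite /e lerBlDl bd.
Qed.

(** On the unit interval, [h (x * p)] divided by [M] to the power [x] is midpoint log-convex and at
    most 1 at both ends. It thus stays at most 1, and [x = 1 / p] gives the claim. *)
Lemma log_midconvex_powR_le (h : R -> R) (p c : R) : 1 <= p ->
  (forall t : R, 0 <= t <= p -> 0 <= h t <= c) -> h 0 <= 1 ->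
  (forall s t : R, 0 <= s <= p -> 0 <= t <= p -> h ((s + t) / 2) ^+ 2 <= h s * h t) ->
  powR (h 1) p <= h p.
Proof.
move=> p1 h_bd h01 h_mid; have p0 : 0 < p by lra.
have h_ge0 (t : R) : 0 <= t <= p -> 0 <= h t by move=> /h_bd/andP[].
(* The value [h p] may vanish, whereas division by powers of [M] needs [M > 0]; so [M] is any
   positive bound of [h p]. If the claim failed, the midpoint of [h p] and [powR (h 1) p] would be a
   contradictory choice. *)
suff key (M : R) : 0 < M -> h p <= M -> powR (h 1) p <= M.
  rewrite leNgt; apply/negP => hp.
  have hp0 : 0 <= h p by apply: h_ge0; lra.
  by have := @key ((h p + powR (h 1) p) / 2); lra.
move=> M0 hpM.
(* On [[0, 1]] one has [phi x ^+ 2 <= phi (2 * x)] or [phi x ^+ 2 <= phi (2 * x - 1)],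
   according to the half in which [x] lies; so [phi <= 1], without continuity. *)
pose phi (x : {x : R | 0 <= x <= 1}) := h (sval x * p) * powR M (- sval x).
have xp (x : R) : 0 <= x <= 1 -> 0 <= x * p <= p.
  by move=> /andP[x0 x1]; rewrite mulr_ge0 ?(ltW p0)// ler_piMl ?(ltW p0).
have i0p : 0 <= (0 : R) <= p by rewrite lexx (ltW p0).
have ipp : 0 <= p <= p by rewrite lexx (ltW p0).
have Mexp x y : powR M (x + y) = powR M x * powR M y.
  by rewrite powRD// (gt_eqF M0) implybT.
have phi1 : forall x, phi x <= 1.
  (* The factor [powR M (- x)] is [powR (powR M (-1)) x], which [powR_le_bound] controls for [x]
     between 0 and 1. *)
  apply: (@le1_of_sqr_le _ _ (c * (1 + powR (powR M (-1)) 1))) => [[x x01]|[x x01]].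
    have /andP[hx0 hxc] := h_bd _ (xp _ x01).
    rewrite /phi/= mulr_ge0 ?powR_ge0//=; apply: ler_pM; rewrite ?powR_ge0//.
    by rewrite -[- x]mulN1r powRrM powR_le_bound// powR_ge0.
  have /andP[x0 x1] := x01.
  have sqE : (h (x * p) * powR M (- x)) ^+ 2 =
      h (x * p) ^+ 2 * powR M (- (2 * x)).
    by rewrite exprMn [powR _ _ ^+ 2]expr2 -Mexp; congr (_ * powR M _); ring.
  rewrite /phi/= sqE; have [x2|/ltW x2] := leP x (1 / 2).
    have y01 : 0 <= 2 * x <= 1 by lra.
    exists (exist _ (2 * x) y01) => /=; apply: ler_wpM2r; first exact: powR_ge0.
    have -> : x * p = (0 + 2 * x * p) / 2 by field.
    apply: (le_trans (h_mid _ _ i0p (xp _ y01))).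
    by rewrite ler_piMl// h_ge0// xp.
  have y01 : 0 <= 2 * x - 1 <= 1 by lra.
  exists (exist _ (2 * x - 1) y01) => /=.
  have -> : - (2 * x) = - (2 * x - 1) + - 1 by ring.
  rewrite Mexp (powR_inv1 (ltW M0)) mulrCA [leRHS]mulrC.
  apply: ler_wpM2l; first exact: powR_ge0.
  rewrite ler_pdivrMr//.
  have -> : x * p = ((2 * x - 1) * p + p) / 2 by field.
  apply: (le_trans (h_mid _ _ (xp _ y01) ipp)).
  by apply: ler_wpM2l => //; rewrite h_ge0// xp.
have q01 : 0 <= p^-1 <= 1 by rewrite invr_ge0 (ltW p0) invf_le1.
have := phi1 (exist _ p^-1 q01); rewrite /phi/= mulVf ?gt_eqF// powRN.
rewrite ler_pdivrMr ?powR_gt0// mul1r => h1M.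
have h1 : 0 <= h 1 by apply: h_ge0; rewrite ler01.
have := @ge0_ler_powR _ p (ltW p0) _ _ h1 (powR_ge0 _ _) h1M.
by rewrite -powRrM mulVf ?gt_eqF// powRr1// ltW.
Qed.
End LogConvex.

(** * Bounded families of matrices *)

Definition mx_bounded (C : numDomainType) (T : Type) (S : T -> Prop) m n
    (F : T -> 'M[C]_(m, n)) :=
  exists c : C, forall t, S t -> forall i j, `|F t i j| <= c.

Lemma mx_bounded_cst (C : numDomainType) T (S : T -> Prop) m n (A : 'M[C]_(m, n)) :
  mx_bounded S (fun=> A).
Proof.
exists (\sum_i \sum_j `|A i j|) => _ _ i j.
rewrite (bigD1 i)//= (bigD1 j)//= -addrA lerDl.
by rewrite addr_ge0 ?sumr_ge0// => l _; rewrite ?sumr_ge0.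
Qed.

Lemma mx_boundedM (C : numDomainType) T (S : T -> Prop) m n p
    (F : T -> 'M[C]_(m, n)) (G : T -> 'M[C]_(n, p)) :
  mx_bounded S F -> mx_bounded S G -> mx_bounded S (fun t => F t *m G t).
Proof.
move=> [a Fa] [b Gb]; exists (\sum_(l < n) a * b) => t St i j.
rewrite mxE (le_trans (ler_norm_sum _ _ _))//; apply: ler_sum => l _.
by rewrite normrM ler_pM ?Fa ?Gb.
Qed.

Lemma mx_boundedD (C : numDomainType) T (S : T -> Prop) m n
    (F G : T -> 'M[C]_(m, n)) :
  mx_bounded S F -> mx_bounded S G -> mx_bounded S (fun t => F t + G t).
Proof.
move=> [a Fa] [b Gb]; exists (a + b) => t St i j.
by rewrite mxE (le_trans (ler_normD _ _))// lerD ?Fa ?Gb.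
Qed.

Lemma mx_boundedZ (C : numDomainType) T (S : T -> Prop) m n (a : C)
    (F : T -> 'M[C]_(m, n)) :
  mx_bounded S F -> mx_bounded S (fun t => a *: F t).
Proof.
move=> [b Fb]; exists (`|a| * b) => t St i j.
by rewrite mxE normrM ler_wpM2l ?Fb.
Qed.

(** Only the diagonal factor depends on [t], and [powR_le_bound] bounds its entries uniformly. *)
Lemma mx_bounded_mxpow (R : realType) n (A : 'M[R[i]]_n) (p : R) : psdmx A ->
  mx_bounded (fun t : R => 0 <= t <= p) (fun t => mxpow A t).
Proof.
move=> Ap; rewrite /mxpow; apply: mx_boundedM; last exact: mx_bounded_cst.
apply: mx_boundedM; first exact: mx_bounded_cst.
pose x i := complex.Re (spectral_diag A 0 i).
have x0 i : 0 <= x i by exact: Re_spectral_diag_ge0.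
have bd0 i : 0 <= 1 + powR (x i) p by rewrite addr_ge0 ?powR_ge0.
exists (\sum_i (1 + powR (x i) p))%:C => t tp i j.
rewrite !mxE; case: (i == j); last first.
  by rewrite mulr0n normr0 ler0c sumr_ge0.
rewrite mulr1n ger0_norm ?ler0c ?powR_ge0// lecR (bigD1 i)//=.
apply: (le_trans (powR_le_bound (x0 i) tp)).
by rewrite lerDl sumr_ge0.
Qed.

Lemma eigprod_bounded (R : realType) T (S : T -> Prop) n k (F : T -> 'M[R[i]]_n) :
  (k <= n)%N -> (forall t, S t -> psdmx (F t)) -> mx_bounded S F ->
  exists c : R, forall t, S t -> 0 <= eigprod k (F t) <= c.
Proof.
move=> kn Fp [c Fc]; exists (complex.Re ((\sum_(i < n) c) ^+ k)) => t St.
rewrite (eigprod_ge0 kn (Fp _ St))/=.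
suff : (eigprod k (F t))%:C <= (\sum_(i < n) c) ^+ k by rewrite lecE => /andP[].
apply: (le_trans (eigprod_le_trace kn (Fp _ St))).
have tr0 : 0 <= \tr (F t) by apply: sumr_ge0 => i _; apply/psdmx_diag_ge0/Fp.
rewrite -(ger0_norm tr0); apply: lerXn2r; rewrite ?nnegrE//.
  by apply: sumr_ge0 => i _; apply: le_trans (Fc _ St i i).
by rewrite (le_trans (ler_norm_sum _ _ _))//; apply: ler_sum => i _; exact: Fc.
Qed.

(** * Factoring a matrix through its absolute values *)

Lemma gram_eq0 (C : numClosedFieldType) m n (X : 'M[C]_(m, n)) :
  X ^t* *m X = 0 -> X = 0.
Proof.
move=> XX; apply/matrixP => i j; have /matrixP/(_ j j) := XX; rewrite !mxE.
under eq_bigr do rewrite !mxE mulrC -normCK.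
move=> /psumr_eq0P XX0; apply/eqP; rewrite -normr_eq0 -sqrf_eq0.
by rewrite XX0// => l _; exact: exprn_ge0.
Qed.

Section Factorization.
Variables (R : realType) (n : nat).
Implicit Types (M T : 'M[R[i]]_n).

Lemma mxpow_trmxC M q : (mxpow M q) ^t* = mxpow M q.
Proof. exact/psdmx_trmxC/mxpow_psd. Qed.

Lemma mxpowDge0 M (q r : R) : 0 <= q -> 0 <= r -> psdmx M ->
  mxpow M q *m mxpow M r = mxpow M (q + r).
Proof.
move=> q0 r0; apply: mxpowD => x _.
have [qr|qr] := eqVneq (q + r) 0; last by rewrite powRD// (negbTE qr).
move/eqP: (qr); rewrite paddr_eq0// => /andP[/eqP-> /eqP->].
by rewrite addr0 powRr0 mulr1.
Qed.

Lemma mxpowD_neq0 M (q r s : R) : q + r = s -> s != 0 -> psdmx M ->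
  mxpow M q *m mxpow M r = mxpow M s.
Proof.
by move=> <- qr; apply: mxpowD => x _; rewrite powRD// (negbTE qr).
Qed.

(* With [M := T ^t* *m T], the factors are [L := M^(-1/4) *m T ^t*] and
   [Q := M^(1/4)], negative powers being pseudo-inverses since [powR 0 q = 0] for
   [q != 0]. *)
Lemma mxabs_factor T : exists L Q : 'M[R[i]]_n,
  [/\ L ^t* *m Q = T, L ^t* *m L = mxabs (T ^t*) & Q ^t* *m Q = mxabs T].
Proof.
pose M := T ^t* *m T; pose N := T *m T ^t*.
have Mp : psdmx M := psdmx_gram T.
have Np : psdmx N by rewrite /N -[T in T *m _]trmxCK; exact: psdmx_gram.
have q4 : 4^-1 + 4^-1 = 2^-1 :> R by lra.
have q2 : 2^-1 != 0 :> R by rewrite invr_eq0 pnatr_eq0.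
have LE : (mxpow M (- 4^-1) *m T ^t*) ^t* = T *m mxpow M (- 4^-1).
  by rewrite trmxC_mul trmxCK mxpow_trmxC.
exists (mxpow M (- 4^-1) *m T ^t*), (mxpow M 4^-1).
rewrite LE mxpow_trmxC; split.
(* [Pi] is the projection onto the range of [M]. As [M *m Pi = M], the difference [T - T *m Pi] has
   zero Gram matrix, so [T *m Pi = T]. *)
- pose Pi := mxpow M (- 4^-1) *m mxpow M 4^-1.
  have MPi : M *m Pi = M.
    have e1 : 1 + - 4^-1 = 3 / 4 :> R by lra.
    have e2 : 3 / 4 + 4^-1 = 1 :> R by lra.
    have n1 : 3 / 4 != 0 :> R by rewrite mulf_neq0// ?invr_eq0 pnatr_eq0.
    rewrite /Pi -{1}(mxpow1 Mp) mulmxA (mxpowD_neq0 e1 n1 Mp).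
    by rewrite (mxpowD_neq0 e2 (oner_neq0 R) Mp) mxpow1.
  rewrite -mulmxA -/Pi; apply/esym/eqP; rewrite -subr_eq0; apply/eqP/gram_eq0.
  have TPi : T ^t* *m (T - T *m Pi) = 0.
    by rewrite mulmxBr mulmxA -/M MPi subrr.
  have {1}-> : T - T *m Pi = T *m (1%:M - Pi) by rewrite mulmxBr mulmx1.
  by rewrite trmxC_mul -mulmxA TPi mulmx0.
- have e1 : - 4^-1 + - 4^-1 = - 2^-1 :> R by lra.
  have e2 : - 2^-1 + 1 = 2^-1 :> R by lra.
  have n1 : - 2^-1 != 0 :> R by rewrite oppr_eq0.
  (* Intertwining carries the power of [M] across [T]: [T M^(-1/2) T^*] becomes
     [N^(-1/2) N = N^(1/2)]. *)
  have NT : N *m T = T *m M by rewrite mulmxA.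
  rewrite mulmxA -(mulmxA T) (mxpowD_neq0 e1 n1 Mp).
  rewrite -(mxpow_intertwine _ Np Mp NT) -mulmxA -/N -{2}(mxpow1 Np).
  by rewrite (mxpowD_neq0 e2 q2 Np) /mxabs trmxCK.
- by rewrite (mxpowD_neq0 q4 q2 Mp).
Qed.

End Factorization.

(** * The family [P_t] *)

(** The weights turn an average of two products into a single Gram product, to which the Weyl-type
    bounds apply. *)
Definition half_stack (C : numClosedFieldType) m n (X Y : 'M[C]_(m, n)) :=
  col_mx (sqrtC 2^-1 *: X) (sqrtC 2^-1 *: Y).

Lemma half_stack_gram (C : numClosedFieldType) m n (X Y X' Y' : 'M[C]_(m, n)) :
  (half_stack X Y) ^t* *m half_stack X' Y' =
  2^-1 *: (X ^t* *m X' + Y ^t* *m Y').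
Proof.
have sq : sqrtC 2^-1 * (sqrtC 2^-1)^* = 2^-1 :> C.
  by rewrite geC0_conj ?sqrtC_ge0 ?invr_ge0 ?ler0n// -expr2 sqrtCK.
rewrite /half_stack tr_col_mx map_row_mx mul_row_col !linearZ/= !map_mxZ/=.
by rewrite -!scalemxAl !scalerA sq scalerDr.
Qed.

Lemma half_stack_gram_conj (C : numClosedFieldType) n (A X Y X' Y' : 'M[C]_n) :
  A ^t* = A ->
  (half_stack (X *m A) (Y *m A)) ^t* *m half_stack (X' *m A) (Y' *m A) =
  A *m (2^-1 *: (X ^t* *m X' + Y ^t* *m Y')) *m A.
Proof.
move=> AH; rewrite half_stack_gram !trmxC_mul AH -scalemxAr -scalemxAl.
by rewrite mulmxDr mulmxDl !mulmxA.
Qed.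

(** Used with [b *m c = a t *m a s] and [d = a m] at the midpoint [m]: it supplies both spectral
    hypotheses of [eigprod_sqr_le]. *)
Lemma mulmx_sandwich (C : pzRingType) n (a b c d q : 'M[C]_n) :
  b *m c = d *m d ->
  (a *m q *m b) *m (c *m q *m d) = (a *m q *m d) *m (d *m q *m d).
Proof. by move=> bc; rewrite !mulmxA -(mulmxA _ b c) bc !mulmxA. Qed.

(** The properties of the powers of a positive semidefinite matrix on which midpoint convexity
    rests. *)
Definition psd_semigroup (R : realType) n (a : R -> 'M[R[i]]_n) :=
  [/\ a 0 = 1%:M, forall t, psdmx (a t) &
      forall s t, 0 <= s -> 0 <= t -> a s *m a t = a (s + t)].

Lemma psd_semigroup_mxpow (R : realType) n (A : 'M[R[i]]_n) :
  psdmx A -> psd_semigroup (mxpow A).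
Proof.
move=> Ap; split=> [|t|s t s0 t0]; first exact: mxpow0.
  exact: mxpow_psd.
exact: mxpowDge0.
Qed.

Section Sandwich.
Variables (R : realType) (n : nat) (a b1 b2 : R -> 'M[R[i]]_n).
Hypotheses (aS : psd_semigroup a) (b1S : psd_semigroup b1)
  (b2S : psd_semigroup b2).

Definition half_sum (t : R) := 2^-1 *: (b1 t + b2 t).

Definition sandwich (t : R) := a t *m half_sum t *m a t.

Lemma sandwich_psd t : psdmx (sandwich t).
Proof.
have [_ ap _] := aS; have [_ b1p _] := b1S; have [_ b2p _] := b2S.
rewrite /sandwich -{1}(psdmx_trmxC (ap t)); apply/psdmx_conj/psdmxZ.
  by rewrite invr_ge0 ler0n.
exact: psdmxD.
Qed.

Lemma sandwich0 : sandwich 0 = 1%:M.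
Proof.
have [a0 _ _] := aS; have [b10 _ _] := b1S; have [b20 _ _] := b2S.
have e2 : 1%:M + 1%:M = 2 *: 1%:M :> 'M[R[i]]_n by rewrite scaler_nat mulr2n.
rewrite /sandwich /half_sum a0 b10 b20 mulmx1 mul1mx e2 scalerA.
by rewrite mulVf ?pnatr_eq0// scale1r.
Qed.

Definition stack (t : R) := half_stack (b1 (t / 2) *m a t) (b2 (t / 2) *m a t).

Lemma stack_gram s t : 0 <= s -> 0 <= t ->
  (stack s) ^t* *m stack t = a s *m half_sum ((s + t) / 2) *m a t.
Proof.
move=> s0 t0; rewrite half_stack_gram /half_sum.
have [_ ap _] := aS.
have half b : psd_semigroup b ->
    (b (s / 2) *m a s) ^t* *m (b (t / 2) *m a t) = a s *m b ((s + t) / 2) *m a t.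
  move=> [_ bp bD]; rewrite trmxC_mul (psdmx_trmxC (ap s)) (psdmx_trmxC (bp _)).
  by rewrite mulrDl -bD ?divr_ge0// !mulmxA.
rewrite (half _ b1S) (half _ b2S) -scalemxAr -scalemxAl.
by rewrite mulmxDr mulmxDl.
Qed.

Lemma eigprod_sandwich_midconvex k s t : (k <= n)%N -> 0 <= s -> 0 <= t ->
  eigprod k (sandwich ((s + t) / 2)) ^+ 2 <=
  eigprod k (sandwich s) * eigprod k (sandwich t).
Proof.
move=> kn s0 t0; pose m := (s + t) / 2; rewrite -/m.
have m0 : 0 <= m by rewrite divr_ge0 ?addr_ge0.
have [_ _ aD] := aS.
have aa : a t *m a s = a m *m a m.
  by rewrite !aD//; congr a; rewrite /m; lra.
have gramE r : 0 <= r -> sandwich r = (stack r) ^t* *m stack r.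
  move=> r0; have rr : (r + r) / 2 = r by lra.
  by rewrite (stack_gram r0 r0) rr.
rewrite (gramE s s0) (gramE t t0).
apply: (@eigprod_sqr_le _ _ _ kn _ _ _ _ (a s *m half_sum m *m a m)
  (a m *m half_sum m *m a t)).
- exact: sandwich_psd.
- by rewrite (stack_gram s0 t0) -/m; exact: mulmx_sandwich.
- exact: mulmx_sandwich.
Qed.

Lemma eigprod_sandwich_le k p : (k <= n)%N -> 1 <= p ->
  let I (t : R) := 0 <= t <= p in
  mx_bounded I a -> mx_bounded I b1 -> mx_bounded I b2 ->
  powR (eigprod k (sandwich 1)) p <= eigprod k (sandwich p).
Proof.
move=> kn p1 I abd b1bd b2bd.
have [] := @eigprod_bounded R R I n k sandwich kn.
- by move=> t _; exact: sandwich_psd.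
- apply: mx_boundedM => //; apply: mx_boundedM => //.
  exact/mx_boundedZ/mx_boundedD.
move=> c bd; apply: (log_midconvex_powR_le p1 bd).
  by rewrite sandwich0 eigprod1.
by move=> s t /andP[s0 _] /andP[t0 _]; exact: eigprod_sandwich_midconvex.
Qed.

End Sandwich.

(** * The real part of [T] and the conclusion *)

(** Stack [L *m A] over [Q *m A], and the same blocks in the opposite order: the mixed Gram product
    is [H], while both stacks have the same Gram matrix. *)
Lemma eigprod_cross_gram_le (R : realType) n k (A L Q : 'M[R[i]]_n)
    (H := A *m (2^-1 *: (L ^t* *m Q + Q ^t* *m L)) *m A) :
  (k <= n)%N -> A ^t* = A ->
  eigprod k (H ^t* *m H) <=
  eigprod k (A *m (2^-1 *: (Q ^t* *m Q + L ^t* *m L)) *m A) ^+ 2.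
Proof.
move=> kn AH.
rewrite expr2; apply: (eigprod_gram_mul_le kn (half_stack_gram_conj L Q Q L AH)).
  by rewrite (half_stack_gram_conj L Q L Q AH) [_ *m L + _]addrC.
exact: half_stack_gram_conj.
Qed.

Lemma eigprod_sqr_Re_le (R : realType) n k (A T : 'M[R[i]]_n)
    (H := A *m (2^-1 *: (T + T ^t*)) *m A) : (k <= n)%N -> A ^t* = A ->
  eigprod k (H ^t* *m H) <=
  eigprod k (A *m (2^-1 *: (mxabs T + mxabs (T ^t*))) *m A) ^+ 2.
Proof.
move=> kn AH; have [L [Q [LQ LL QQ]]] := mxabs_factor T.
have QL : Q ^t* *m L = T ^t* by rewrite -LQ trmxC_mul trmxCK.
by have := eigprod_cross_gram_le L Q kn AH; rewrite QL LQ LL QQ.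
Qed.

Lemma eigprod_mxpow_sandwich_le (R : realType) n k (A B1 B2 : 'M[R[i]]_n) (p : R) :
  (k <= n)%N -> 1 <= p -> psdmx A -> psdmx B1 -> psdmx B2 ->
  powR (eigprod k (A *m (2^-1 *: (B1 + B2)) *m A)) p <=
  eigprod k (mxpow A p *m (2^-1 *: (mxpow B1 p + mxpow B2 p)) *m mxpow A p).
Proof.
move=> kn p1 Ap B1p B2p.
have := eigprod_sandwich_le (psd_semigroup_mxpow Ap) (psd_semigroup_mxpow B1p)
  (psd_semigroup_mxpow B2p) kn p1 (mx_bounded_mxpow p Ap)
  (mx_bounded_mxpow p B1p) (mx_bounded_mxpow p B2p).
by rewrite {1}/sandwich {1}/half_sum (mxpow1 Ap) (mxpow1 B1p) (mxpow1 B2p).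
Qed.

Lemma eigprod_mxabs (R : realType) n k (H : 'M[R[i]]_n) : (k <= n)%N ->
  eigprod k (mxabs H) = Num.sqrt (eigprod k (H ^t* *m H)).
Proof.
move=> kn; have half0 : 0 <= 2^-1 :> R by rewrite invr_ge0 ler0n.
rewrite (eigprod_mxpow kn half0 (psdmx_gram H)) powR12_sqrt//.
exact: eigprod_gram_ge0.
Qed.

Lemma eigprod_mxabs_Re_le (R : realType) n k (A T : 'M[R[i]]_n) :
  (k <= n)%N -> psdmx A ->
  eigprod k (mxabs (A *m (2^-1 *: (T + T ^t*)) *m A)) <=
  eigprod k (A *m (2^-1 *: (mxabs T + mxabs (T ^t*))) *m A).
Proof.
move=> kn Ap; have AH := psdmx_trmxC Ap.
have Sp : psdmx (A *m (2^-1 *: (mxabs T + mxabs (T ^t*))) *m A).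
  rewrite -{1}AH; apply/psdmx_conj/psdmxZ; first by rewrite invr_ge0 ler0n.
  by apply: psdmxD; exact: mxpow_psd.
rewrite eigprod_mxabs// -(ger0_norm (eigprod_ge0 kn Sp)) -sqrtr_sqr.
exact/ler_wsqrtr/eigprod_sqr_Re_le.
Qed.

Theorem corollary2p13 (R : realType) (n : nat) (A : 'M[R[i]]_n) (p : R)
  (hA : psdmx A) (hp : 1 <= p) (T : 'M[R[i]]_n) :
  wlog_majorized
    (mxpow (mxabs (A *m (2^-1 *: (T + T ^t*)) *m A)) p)
    (mxpow A p
       *m (2^-1 *: (mxpow (mxabs T) p + mxpow (mxabs (T ^t*)) p))
       *m mxpow A p).
Proof.
move=> k /andP[_ kn].
have habs (X : 'M[R[i]]_n) : psdmx (mxabs X) by exact: mxpow_psd.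
have p0 : 0 <= p by lra.
(* With [H] the matrix inside the left-hand [mxabs], the chain is [E_k(|H|^p) = E_k(|H|)^p <=
   E_k(P_1)^p <= E_k(P_p)]; this step is the last inequality. *)
apply: le_trans (eigprod_mxpow_sandwich_le kn hp hA (habs T) (habs (T ^t*))).
rewrite [leLHS](eigprod_mxpow kn p0 (habs (A *m (2^-1 *: (T + T ^t*)) *m A))).
have leS := eigprod_mxabs_Re_le T kn hA.
have H0 := eigprod_ge0 kn (habs (A *m (2^-1 *: (T + T ^t*)) *m A)).
exact: ge0_ler_powR p0 _ _ H0 (le_trans H0 leS) leS.
Qed.
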